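(* Let $F$ be a probability distribution on $\mathbb{R}^d$, let $\mathbf{x}'\in\mathbb{R}^d$, and let $F_s=(1-s)F+s\delta_{\mathbf{x}'}$. Suppose the loss $\rho$ satisfies: (A1) $\rho$ is non-decreasing, $\rho(0)=0$, and $\rho(x)/x\to 0$ as $x\to 0$; (A2) $\varphi(0)\triangleq\lim_{x\to 0}\psi(x)/x$ exists and is finite; (A3) $\psi$ and $\varphi$ are continuous; (A4) $\psi$ and $\varphi$ are bounded; (A5) $\varphi$ is Lipschitz continuous. In addition, assume that $f_{F_s}\to f_F$ (in $\mathcal{H}$) as $s\to 0$. If $\dot{f}_F\triangleq\lim_{s\to 0}\frac{f_{F_s}-f_F}{s}$ exists (in $\mathcal{H}$), then for all $\mathbf{x}\in\mathbb{R}^d$ $$IF(\mathbf{x},\mathbf{x}';\widehat{f}_{RKDE},F)=\langle\Phi(\mathbf{x}),\dot{f}_F\rangle_{\mathcal{H}},$$ where $\dot{f}_F\in\mathcal{H}$ satisfies $$\Bigl(\int\varphi(\|\Phi(\mathbf{x})-f_F\|_{\mathcal{H}})\,dF(\mathbf{x})\Bigr)\cdot\dot{f}_F+\int\Bigl(\frac{\langle\dot{f}_F,\Phi(\mathbf{x})-f_F\rangle_{\mathcal{H}}}{\|\Phi(\mathbf{x})-f_F\|_{\mathcal{H}}^3}\cdot q(\|\Phi(\mathbf{x})-f_F\|_{\mathcal{H}})\cdot(\Phi(\mathbf{x})-f_F)\Bigr)dF(\mathbf{x})=(\Phi(\mathbf{x}')-f_F)\cdot\varphi(\|\Phi(\mathbf{x}')-f_F\|_{\mathcal{H}}),$$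 with $q(x)=x\psi'(x)-\psi(x)$.
   Context: The kernel $k_\sigma:\mathbb{R}^d\times\mathbb{R}^d\to[0,\infty)$ satisfies $\int k_\sigma(\mathbf{x},\cdot)\,d\mathbf{x}=1$, is radial, meaning $k_\sigma(\mathbf{x},\mathbf{x}')=g_0(\|\mathbf{x}-\mathbf{x}'\|^2)$ for some function $g_0$, and is positive semi-definite. $\mathcal{H}$ is the reproducing kernel Hilbert space (real) associated with $k_\sigma$, and $\Phi(\mathbf{x})\triangleq k_\sigma(\cdot,\mathbf{x})\in\mathcal{H}$ is the canonical feature map, so $g(\mathbf{x})=\langle\Phi(\mathbf{x}),g\rangle_{\mathcal{H}}$ for $g\in\mathcal{H}$. The loss $\rho:[0,\infty)\to\mathbb{R}$ is differentiable, $\psi\triangleq\rho'$, and $\varphi(x)\triangleq\psi(x)/x$ for $x>0$; $\psi'$ denotes the derivative of $\psi$. $\delta_{\mathbf{x}'}$ is the point mass at $\mathbf{x}'$. For a probability distribution $\mu$ on $\mathbb{R}^d$, $f_\mu=\arg\min_{g\in\mathcal{H}}\int\rho(\|\Phi(\mathbf{x})-g\|_{\mathcal{H}})\,d\mu(\mathbf{x})$ and $\widehat{f}_{RKDE}(\mathbf{x};\mu)=f_\mu(\mathbf{x})=\langle\Phi(\mathbf{x}),f_\mu\rangle_{\mathcal{H}}$. For a function estimate $T(\mathbf{x};F)$ based on a distribution $F$ and evaluated at $\mathbf{x}$, the influence function is $$IF(\mathbf{x},\mathbf{x}';T,F)=\lim_{s\to 0}\frac{T(\mathbf{x};F_s)-T(\mathbf{x};F)}{s},\qquad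 F_s=(1-s)F+s\delta_{\mathbf{x}'},\ s\in[0,1).$$ $\mathcal{H}$-valued integrals are Bochner integrals.
   Formalization: Two implicit prerequisites are made explicit: Φ is strongly (Bochner) measurable with respect to F, and ψ is differentiable at ‖Φ(x)−f_F‖ for F-almost every x with Φ(x)≠f_F; without them the second integral or q can be undefined. *)

(* Defs.v *)
From HB Require Import structures.
From mathcomp Require Import all_boot all_order all_algebra.
From mathcomp Require Import all_classical all_reals all_analysis.
Import Order.TTheory GRing.Theory Num.Theory.
Import numFieldNormedType.Exports.

Set Implicit Arguments.
Unset Strict Implicit.
Unset Printing Implicit Defensive.

Local Open Scope classical_set_scope.
Local Open Scope ring_scope.

(* R^d is d.-tuple R with the product sigma-algebra of the library, which is
   the Borel sigma-algebra. *)

Definition sqdist (R : realType) (d : nat) (x y : d.-tuple R) : R :=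
  \sum_(i < d) (tnth x i - tnth y i) ^+ 2.

(** Lebesgue measure on R^d: the image of lebesgue_measure \x leb under
    (x, t) |-> x :: t, iterated from the unit mass on the point R^0. *)

Definition tcons (R : realType) (n : nat) (p : measurableTypeR R * n.-tuple R) : n.+1.-tuple R :=
  [tuple of p.1 :: p.2].

Lemma measurable_tcons (R : realType) (n : nat) :
  measurable_fun [set: measurableTypeR R * n.-tuple R] (@tcons R n).
Proof. exact: measurable_cons. Qed.

Section leb_step.
Context (R : realType) (n : nat)
  (m : {sigma_finite_measure set (n.-tuple R) -> \bar R}).

Definition leb_step : set (n.+1.-tuple R) -> \bar R :=
  pushforward (@lebesgue_measure R \x m)%E (@tcons R n).

Let mtcons : measurable_fun setT (@tcons R n) := @measurable_tcons R n.

Let leb_step0 : leb_step set0 = 0%E.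
Proof. by rewrite /leb_step /pushforward preimage_set0 measure0. Qed.

Let leb_step_ge0 A : (0 <= leb_step A)%E.
Proof. exact: measure_ge0. Qed.

Let leb_step_sigma_additive : semi_sigma_additive leb_step.
Proof.
move=> F mF tF mUF; rewrite /leb_step /pushforward preimage_bigcup.
apply: measure_semi_sigma_additive.
- by move=> k; rewrite -[X in measurable X]setTI; exact: mtcons.
- apply/trivIsetP => /= i j _ _ ij; rewrite -preimage_setI.
  by move/trivIsetP : tF => /(_ _ _ _ _ ij) ->//; rewrite preimage_set0.
- by rewrite -preimage_bigcup -[X in measurable X]setTI; exact: mtcons.
Qed.

HB.instance Definition _ := isMeasure.Build _ _ _ leb_step
  leb_step0 leb_step_ge0 leb_step_sigma_additive.

Let leb_step_sigma_finite : sigma_finite [set: n.+1.-tuple R] leb_step.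
Proof.
pose g (t : n.+1.-tuple R) : measurableTypeR R * n.-tuple R :=
  (thead t, [tuple of behead t]).
have gK (p : measurableTypeR R * n.-tuple R) : g (tcons p) = p.
  by case: p => x t; rewrite /g theadE; congr pair; apply: val_inj.
have mg : measurable_fun [set: n.+1.-tuple R] g.
  by apply/measurable_fun_pair; [exact: measurable_tnth|exact: measurable_behead].
have /sigma_finiteP[F [FT ndF Foo]] := sigma_finiteT (@lebesgue_measure R).
have /sigma_finiteP[G [GT ndG Goo]] := sigma_finiteT m.
exists (fun k => g @^-1` (F k `*` G k)).
  apply/esym/seteqP; split=> // t _.
  have [i _ Fi] : (\bigcup_i F i) (g t).1 by rewrite -FT.
  have [j _ Gj] : (\bigcup_i G i) (g t).2 by rewrite -GT.
  exists (maxn i j) => //; split.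
    by move: Fi; exact/subsetPset/ndF/leq_maxl.
  by move: Gj; exact/subsetPset/ndG/leq_maxr.
move=> k; have [mF Fk] := Foo k; have [mG Gk] := Goo k; split.
  by rewrite -[X in measurable X]setTI; apply: mg => //; exact: measurableX.
rewrite /leb_step /pushforward (_ : _ @^-1` _ = F k `*` G k); last first.
  by apply/seteqP; split=> p; rewrite /preimage /mkset gK.
by rewrite product_measure1E// lte_mul_pinfty// ge0_fin_numE.
Qed.

HB.instance Definition _ :=
  Measure_isSigmaFinite.Build _ _ _ leb_step leb_step_sigma_finite.

End leb_step.

Fixpoint leb (R : realType) (d : nat) :
    {sigma_finite_measure set (d.-tuple R) -> \bar R} :=
  if d is n.+1 then leb_step (leb R n) else @dirac _ (0.-tuple R) [tuple] R.

Lemma leb_box (R : realType) (d : nat) (A : 'I_d -> set R) :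
  (forall i, measurable (A i)) ->
  leb R d [set t | forall i, A i (tnth t i)] =
  (\prod_(i < d) lebesgue_measure (A i))%E.
Proof.
elim: d A => [|n IHn] A mA /=.
  by rewrite big_ord0 diracE mem_set // => -[].
rewrite big_ord_recl -IHn; last by move=> i; exact: mA.
have mB : measurable [set t : n.-tuple R | forall i, A (lift ord0 i) (tnth t i)].
  rewrite (_ : mkset _ = \bigcap_(i in [set: 'I_n])
      ((@tnth n R ^~ i) @^-1` A (lift ord0 i))); last first.
    by apply/seteqP; split=> t /= At i; [move=> _|]; exact: At.
  apply: fin_bigcap_measurable => // i _; rewrite -[X in measurable X]setTI.
  exact: measurable_tnth.
have mA0 : measurable (A ord0 : set (measurableTypeR R)) by exact: mA.
rewrite -[RHS](product_measure1E lebesgue_measure (leb R n) mA0 mB).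
congr (product_measure1 _ _ _).
apply/seteqP; split=> [[x t] /= At|[x t] /= [Ax At] i].
  split; first by have := At ord0.
  by move=> i; have := At (lift ord0 i); rewrite tnthS.
case: (unliftP ord0 i) => [j|] ->; last by [].
by rewrite tnthS; exact: At.
Qed.

Record density_kernel (R : realType) (d : nat)
    (k : d.-tuple R -> d.-tuple R -> R) : Prop := DensityKernel {
  kernel_ge0 : forall x y, 0 <= k x y ;
  kernel_measurable : forall x, measurable_fun [set: d.-tuple R] (k x) ;
  kernel_integral1 : forall x, (\int[leb R d]_y (k x y)%:E = 1)%E ;
  kernel_radial : exists g0 : R -> R, forall x y, k x y = g0 (sqdist x y) ;
  kernel_psd : forall (n : nat) (x : 'I_n -> d.-tuple R) (c : 'I_n -> R),
    0 <= \sum_(i < n) \sum_(j < n) c i * c j * k (x i) (x j) }.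

(** H is a real Hilbert space for dot. Its elements are functions on X through
    the injection ev, which the reproducing property makes linear. *)
Record is_rkhs (R : realType) (X : Type) (k : X -> X -> R)
    (H : completeNormedModType R) (dot : {dot H for idfun})
    (ev : H -> X -> R) (Phi : X -> H) : Prop := IsRKHS {
  rkhs_norm : forall g : H, `|g| ^+ 2 = dot g g ;
  rkhs_ev_inj : injective ev ;
  rkhs_feature : forall x y, ev (Phi x) y = k y x ;
  rkhs_reproducing : forall g x, ev g x = dot (Phi x) g }.

Section loss.
Context (R : realType) (rho : R -> R).

(* A loss is a function on [0, +oo[: the values of rho at negative reals are
   never used, so the derivative at 0 is one-sided. *)
Definition loss_quotient0 (h : R) : R := (rho h - rho 0) / h.

Definition loss_differentiable : Prop :=
  cvg (loss_quotient0 h @[h --> 0^'+]) /\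
  forall x, 0 < x -> derivable rho x 1.

Definition psi (x : R) : R :=
  if x == 0 then lim (loss_quotient0 h @[h --> 0^'+]) else (rho^`())%classic x.

Definition phi (x : R) : R :=
  if x == 0 then lim (psi h / h @[h --> 0^'+]) else psi x / x.

Definition qfun (x : R) : R := x * (psi^`())%classic x - psi x.

Record loss_assumptions : Prop := LossAssumptions {
  loss_nondecreasing : {in `[0, +oo[ &, {homo rho : x y / x <= y}} ;
  loss_0 : rho 0 = 0 ;
  loss_small : rho x / x @[x --> 0^'+] --> 0 ;
  phi_cvg0 : cvg (psi x / x @[x --> 0^'+]) ;
  psi_continuous : {within `[0, +oo[, continuous psi} ;
  phi_continuous : {within `[0, +oo[, continuous phi} ;
  psi_bounded : [bounded psi x | x in `[0, +oo[] ;
  phi_bounded : [bounded phi x | x in `[0, +oo[] ;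
  phi_lipschitz : [lipschitz phi x | x in `[0, +oo[] }.

End loss.

Section bochner.
Context d (T : measurableType d) (R : realType) (mu : probability T R)
  (V : normedModType R).

Definition simple_fun (s : T -> V) : Prop :=
  finite_set (range s) /\ forall v, measurable (s @^-1` [set v]).

Definition simple_integral (s : T -> V) : V :=
  \sum_(v \in range s) fine (mu (s @^-1` [set v])) *: v.

Definition strongly_measurable (f : T -> V) : Prop :=
  exists s : nat -> T -> V, (forall n, simple_fun (s n)) /\
    {ae mu, forall x, s n x @[n --> \oo] --> f x}.

(** f is Bochner integrable with integral v. *)
Definition is_bochner (f : T -> V) (v : V) : Prop :=
  exists s : nat -> T -> V, [/\ forall n, simple_fun (s n),
    {ae mu, forall x, s n x @[n --> \oo] --> f x},
    (\int[mu]_x `|f x - s n x|%:E)%E @[n --> \oo] --> 0%E &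
    simple_integral (s n) @[n --> \oo] --> v].

End bochner.

Section contamination.
Context d (T : measurableType d) (R : realType) (F : probability T R) (x' : T).

(* Clipping s to [0, 1] makes the mixture a probability for every real s; only
   0 <= s < 1 matters. *)
Definition clip01 (s : R) : R := Num.min 1 (Num.max 0 s).

Lemma clip01_ge0 s : 0 <= clip01 s.
Proof. by rewrite /clip01 le_min ler01 le_max lexx. Qed.

Lemma onem_clip01_ge0 s : 0 <= 1 - clip01 s.
Proof. by rewrite subr_ge0 /clip01 ge_min lexx. Qed.

Definition contaminate (s : R) : set T -> \bar R :=
  measure_add (mscale (NngNum (onem_clip01_ge0 s)) F)
              (mscale (NngNum (clip01_ge0 s)) (@dirac _ T x' R)).

HB.instance Definition _ s := Measure.on (contaminate s).

Let contaminate_setT s : contaminate s setT = 1%E.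
Proof.
rewrite /contaminate measure_addE /= /mscale /=.
rewrite (probability_setT F) diracT !mule1.
by rewrite -EFinD subrK.
Qed.

HB.instance Definition _ s :=
  Measure_isProbability.Build _ _ _ (contaminate s) (contaminate_setT s).

Lemma contaminateE (s : R) (A : set T) : 0 <= s < 1 ->
  contaminate s A = ((1 - s)%:E * F A + s%:E * \d_x' A)%E.
Proof.
move=> /andP[s0 s1]; rewrite /contaminate measure_addE /= /mscale /= /clip01.
by rewrite max_r // min_r // ltW.
Qed.

End contamination.

Section influence.
Context d (T : measurableType d) (R : realType) (X : Type)
  (E : X -> probability T R -> R) (F : probability T R) (x : X) (x' : T).

Definition influence_quotient (s : R) : R :=
  (E x (contaminate F x' s) - E x F) / s.

Definition influence_function : R := lim (influence_quotient s @[s --> 0^'+]).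

End influence.

Section rkde.
Context d (T : measurableType d) (R : realType) (H : normedModType R).

Definition robust_risk (rho : R -> R) (Phi : T -> H) (mu : probability T R)
    (g : H) : \bar R := (\int[mu]_x (rho `|Phi x - g|)%:E)%E.

Definition is_argmin (J : H -> \bar R) (f : H) : Prop :=
  forall g, (J f <= J g)%E.

(* fmin mu plays the role of f_mu, a minimizer of robust_risk rho Phi mu. *)
Definition rkde (ev : H -> T -> R) (fmin : probability T R -> H)
    (x : T) (mu : probability T R) : R := ev (fmin mu) x.

End rkde.

(* Main.v *)
Require Import Defs.
From HB Require Import structures.
From mathcomp Require Import all_boot all_order all_algebra.
From mathcomp Require Import all_classical all_reals all_analysis.
From mathcomp Require Import ring lra.
Import Order.TTheory GRing.Theory Num.Theory.
Import numFieldNormedType.Exports.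
Import HBSimple HBNNSimple measurable_realfun.
Local Open Scope classical_set_scope.
Local Open Scope ring_scope.

(** The map [x |-> `|Phi x|] is constant since the kernel is radial, so every
    integrand below is bounded. Differentiating the risk of [g + t h] at [t = 0]
    under the integral shows that a minimizer [g] for the mixture [F_s] satisfies
    [(1 - s) \int phi(|Phi - g|) <Phi - g, h> dF
       + s phi(|Phi x' - g|) <Phi x' - g, h> = 0] for all [h].
    Dividing by [s] the difference of these equations for [g = f_s] and for
    [g = f_F], and letting [s] tend to 0 under the integral, gives the equation of
    the theorem paired with an arbitrary [h]; dominated convergence applies because
    [phi] is Lipschitz. A vector [v] such that
    [<v, h> = \int <Q x, h> dF] for all [h], with [Q] bounded and strongly
    measurable, is the Bochner integral of [Q]: applied to
    [h = \int t_n dF - v], this bounds [`|h|] by [\int `|t_n - Q| dF] for simple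
    [t_n] converging to [Q]. *)

(** * Inner products and derivatives of the norm *)

Section inner_product.
Context {R : realType} {H : normedModType R} (dot : {dot H for idfun}).
Hypothesis dotE : forall g : H, `|g| ^+ 2 = dot g g.

Lemma dotC g h : dot g h = dot h g.
Proof. by rewrite hermC expr0 mul1r. Qed.

Lemma sqr_normD g h : `|g + h| ^+ 2 = `|g| ^+ 2 + 2 * dot g h + `|h| ^+ 2.
Proof. rewrite !dotE linearDl !linearDr /= (dotC h g); ring. Qed.

(** Cauchy-Schwarz, obtained by squaring the triangle inequality that the norm already satisfies. *)
Lemma dot_le_norm g h : dot g h <= `|g| * `|h|.
Proof.
have := ler_normD g h.
rewrite -(@ler_sqr _ `|g + h|) ?nnegrE ?addr_ge0// sqr_normD sqrrD; lra.
Qed.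

Lemma normr_dot_le g h : `|dot g h| <= `|g| * `|h|.
Proof.
by rewrite ler_norml dot_le_norm andbT lerNl -linearNl -(normrN g) dot_le_norm.
Qed.

(** Polarization expresses [dot] through the norm, whose continuity is known. *)
Lemma cvg_dot {I : Type} {G : set_system I} {FG : Filter G} (a b : I -> H) g h :
  a @ G --> g -> b @ G --> h -> (fun i => dot (a i) (b i)) @ G --> dot g h.
Proof.
move=> ag bh.
have polar u v : dot u v = 2^-1 * (`|u + v| * `|u + v| - `|u| * `|u| - `|v| * `|v|).
  by rewrite -!expr2 sqr_normD; field.
rewrite polar; under eq_fun do rewrite polar.
apply: cvgMl_tmp; apply: cvgB; [apply: cvgB|]; apply: cvgM; apply: cvg_norm => //;
  exact: cvgD.
Qed.

(** Derivative of the norm away from 0: the difference of the norms of [w n] and [u] is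
    [dot (w n - u) (w n + u)] divided by the sum of these norms. *)
Lemma cvg_norm_quotient (u v : H) (w : nat -> H) (t : nat -> R) :
  u != 0 -> w @ \oo --> u -> (t n)^-1 *: (w n - u) @[n --> \oo] --> v ->
  (`|w n| - `|u|) / t n @[n --> \oo] --> dot v u / `|u|.
Proof.
move=> u0 wu tv.
have uu0 : `|u| + `|u| != 0 by rewrite -mulr2n mulrn_eq0 normr_eq0.
have -> : dot v u / `|u| = dot v (u + u) * (`|u| + `|u|)^-1.
  by rewrite linearDr /=; field; rewrite -mulr2n mulrn_eq0 /= normr_eq0 u0.
have : dot ((t n)^-1 *: (w n - u)) (w n + u) * (`|w n| + `|u|)^-1 @[n --> \oo]
    --> dot v (u + u) * (`|u| + `|u|)^-1.
  apply: cvgM; first by apply: cvg_dot => //; apply: cvgD => //; exact: cvg_cst.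
  apply: (cvgV uu0); apply: cvgD; [exact: cvg_norm|exact: cvg_cst].
apply: cvg_trans; apply: near_eq_cvg; near=> n.
have wn0 : `|w n| + `|u| != 0.
  by rewrite gt_eqF// ltr_wpDl// normr_gt0.
have -> : dot ((t n)^-1 *: (w n - u)) (w n + u) =
    (t n)^-1 * ((`|w n| - `|u|) * (`|w n| + `|u|)).
  rewrite -subr_sqr !dotE linearZl_LR /= linearBl !linearDr /= (dotC u); ring.
by rewrite mulrA mulfK // mulrC.
Unshelve. all: by end_near. Qed.

End inner_product.

(** * Loss functions *)

(** Chain rule along a filter. Caratheodory's factorization [f y - f x = g y * (y - x)], with [g]
    continuous at [x], avoids dividing by [r i - x], which may vanish. *)
Lemma cvg_difference_quotient {R : realType} {f : R -> R} {x df c : R}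
    {I : Type} {G : set_system I} {FG : Filter G} {r t : I -> R} :
  is_derive x 1 f df -> r @ G --> x -> (r i - x) / t i @[i --> G] --> c ->
  (f (r i) - f x) / t i @[i --> G] --> df * c.
Proof.
move=> /is_derive1_caratheodory[g [fE gx <-]] rx rt.
under eq_fun do rewrite fE -mulrA.
by apply: cvgM => //; exact: continuous_cvg.
Qed.

(** [rho] and [phi] are controlled on nonnegative reals only. A Lipschitz bound there gives
    continuity along nonnegative [r], including at 0. *)
Lemma cvg_lipschitz_ge0 {R : realType} (f : R -> R) (L : R)
    (fL : forall a b, 0 <= a -> 0 <= b -> `|f a - f b| <= L * `|a - b|)
    {I : Type} {G : set_system I} {FG : Filter G} (r : I -> R) (x : R) :
  (forall i, 0 <= r i) -> 0 <= x -> r @ G --> x -> f (r i) @[i --> G] --> f x.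
Proof.
move=> r0 x0 rx; apply/subr_cvg0/norm_cvg0P.
apply: (@squeeze_cvgr _ _ _ _ (fun=> 0) (fun i => L * `|r i - x|)).
- by near=> i; rewrite normr_ge0 fL.
- exact: cvg_cst.
- rewrite -(mulr0 L); apply: cvgMl_tmp; apply/norm_cvg0P; exact/subr_cvg0.
Unshelve. all: by end_near. Qed.

Section loss.
Context {R : realType} {rho : R -> R}.
Hypotheses (drho : loss_differentiable rho) (Arho : loss_assumptions rho).

(** Nonnegativity lets the risk be altered on a null set without knowing that the original integrand
    is measurable. *)
Lemma loss_ge0 (x : R) : 0 <= x -> 0 <= rho x.
Proof.
move=> x0; rewrite -(loss_0 Arho).
by apply: (loss_nondecreasing Arho); rewrite ?in_itv/= ?andbT.
Qed.

Lemma is_derive_loss (x : R) : 0 < x -> is_derive x 1 rho (psi rho x).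
Proof.
move=> x0; rewrite /psi gt_eqF// derive1E; apply: derivableP.
exact: (drho.2 x x0).
Qed.

Lemma psi0 : psi rho 0 = 0.
Proof.
rewrite /psi eqxx; apply/cvg_lim => //.
rewrite /loss_quotient0 (loss_0 Arho); under eq_fun do rewrite subr0.
exact: loss_small Arho.
Qed.

Lemma psiE (x : R) : psi rho x = phi rho x * x.
Proof.
rewrite /phi; case: eqVneq => [->|x0]; first by rewrite psi0 mulr0.
by rewrite divfK.
Qed.

(** For [x > 0], [psi] is a limit of right difference quotients of the non-decreasing [rho]. *)
Lemma psi_ge0 (x : R) : 0 <= x -> 0 <= psi rho x.
Proof.
rewrite le_eqVlt => /predU1P[<-|x0]; first by rewrite psi0.
pose t := @harmonic R.
have t_gt0 n : 0 < t n by rewrite /t /harmonic invr_gt0 ltr0n.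
have rt : (x + t n - x) / t n @[n --> \oo] --> (1 : R).
  under eq_fun do rewrite addrAC subrr add0r divff ?gt_eqF//; exact: cvg_cst.
have rx : x + t n @[n --> \oo] --> x.
  by rewrite -[X in _ --> X]addr0; apply: cvgD; [exact: cvg_cst|exact: cvg_harmonic].
rewrite -[psi _ _]mulr1.
apply: (cvgr_to_ge (cvg_difference_quotient (is_derive_loss x x0) rx rt)); near=> n.
apply: divr_ge0; last exact: ltW.
rewrite subr_ge0; apply: (loss_nondecreasing Arho).
- by rewrite in_itv/= andbT ltW.
- by rewrite in_itv/= andbT addr_ge0 ?ltW.
- by rewrite lerDl ltW.
Unshelve. all: by end_near. Qed.

(** As for [rho], the sign allows the integral of [phi] to be compared with that of a version
    modified on a null set. *)
Lemma phi_ge0 (x : R) : 0 <= x -> 0 <= phi rho x.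
Proof.
rewrite le_eqVlt => /predU1P[<-|x0]; last by rewrite /phi gt_eqF// divr_ge0 ?psi_ge0 ?ltW.
rewrite /phi eqxx; apply: limr_ge; first exact: phi_cvg0 Arho.
near=> h; have h0 : 0 <= h by exact: ltW.
by rewrite divr_ge0 ?psi_ge0.
Unshelve. all: by end_near. Qed.

Lemma bounded_ge0P {f : R -> R} : [bounded f x | x in `[0, +oo[] ->
  exists2 B, 0 < B & forall x, 0 <= x -> `|f x| <= B.
Proof.
(* Boundedness supplies an estimate for every number strictly above [M]; this one is also
   positive. *)
move=> [M [_ fM]]; exists (Num.max M 0 + 1).
  by rewrite ltr_wpDl// le_max lexx orbT.
move=> x x0; apply: (fM (Num.max M 0 + 1)); last by rewrite /= in_itv/= x0.
by rewrite (@le_lt_trans _ _ (Num.max M 0)) ?ltrDl// le_max lexx.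
Qed.

Lemma phi_lipschitzP : exists2 L, 0 <= L &
  forall a b, 0 <= a -> 0 <= b -> `|phi rho a - phi rho b| <= L * `|a - b|.
Proof.
have [M [_ ML]] := phi_lipschitz Arho.
exists (Num.max M 0 + 1); first by rewrite addr_ge0// le_max lexx orbT.
move=> a b a0 b0; apply: (ML _ _ (a, b)); last by rewrite /= !in_itv/= a0 b0.
by rewrite (@le_lt_trans _ _ (Num.max M 0)) ?ltrDl// le_max lexx.
Qed.

(** [psi] is bounded, so the mean value theorem gives the estimate on intervals of positive reals;
    intervals starting at 0 are reached through the smallness of [rho] there. *)
Lemma loss_lipschitzP : exists2 B, 0 <= B &
  forall a b, 0 <= a -> 0 <= b -> `|rho a - rho b| <= B * `|a - b|.
Proof.
have [B B0 psiB] := bounded_ge0P (psi_bounded Arho).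
have loss_mvt a b : 0 < a -> a <= b -> rho b - rho a <= B * (b - a).
  move=> a0 ab.
  have [c||c /itvP cab ->] := @MVT_segment _ rho (psi rho) a b ab.
  - by move=> /itvP cab; apply: is_derive_loss; rewrite (lt_trans a0)// cab.
  - apply: derivable_within_continuous => z' /itvP zab.
    by apply: (drho.2 z'); rewrite (lt_le_trans a0)// zab.
  - rewrite ler_wpM2r ?subr_ge0//; apply: (le_trans (ler_norm _)).
    by apply: psiB; rewrite (le_trans (ltW a0))// cab.
have loss_mvt0 b : 0 <= b -> rho b <= B * b.
  rewrite le_eqVlt => /predU1P[<-|b0]; first by rewrite (loss_0 Arho) mulr0.
  (* The interval is cut at a small [a > 0]: [rho a <= B * a] because [rho a / a] tends to 0, and
     the mean value estimate covers the rest up to [b]. *)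
  near (0 : R)^'+ => a.
  have a0 : 0 < a by [].
  have ab : a <= b by near: a; exact: nbhs_right_le.
  have : rho a / a <= B.
    near: a; apply: (cvgr_le 0); [exact: loss_small Arho|exact: B0].
  rewrite ler_pdivrMr//; have := loss_mvt a b a0 ab; lra.
have key a b : 0 <= a -> a <= b -> `|rho b - rho a| <= B * (b - a).
  move=> a0 ab; rewrite ger0_norm ?subr_ge0; last first.
    by apply: (loss_nondecreasing Arho); rewrite ?in_itv/= ?a0 ?(le_trans a0).
  move: a0; rewrite le_eqVlt => /predU1P[a0|a0]; last exact: loss_mvt.
  by rewrite -a0 (loss_0 Arho) !subr0 loss_mvt0// a0.
exists B; first exact: ltW.
move=> a b a0 b0; have [ab|ba] := leP a b.
  by rewrite distrC (distrC a) (ger0_norm (_ : 0 <= b - a)) ?subr_ge0// key.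
by rewrite (ger0_norm (_ : 0 <= a - b)) ?subr_ge0 ?(ltW ba)// key// ltW.
Unshelve. all: by end_near. Qed.

(** Quotient rule: the derivative of [psi x / x] at [x > 0] is [qfun rho x / x ^+ 2]. This is where
    [qfun] comes from. *)
Lemma cvg_phi_quotient {x c : R} {I : Type} {G : set_system I} {FG : Filter G}
    {r t : I -> R} : 0 < x -> derivable (psi rho) x 1 ->
  (forall i, 0 <= r i) -> r @ G --> x -> (r i - x) / t i @[i --> G] --> c ->
  (phi rho (r i) - phi rho x) / t i @[i --> G] --> qfun rho x / x ^+ 2 * c.
Proof.
move=> x0 /derivableP; rewrite -derive1E => dx r0 rx rt.
have x_neq0 : x != 0 by rewrite gt_eqF.
have lim_psi := @cvg_difference_quotient _ _ _ _ _ _ _ FG _ _ dx rx rt.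
have rV : (r i)^-1 @[i --> G] --> x^-1 by exact: (cvgV x_neq0 rx).
have -> : qfun rho x / x ^+ 2 * c =
    (psi rho)^`()%classic x * c * x^-1 - psi rho x / x * c * x^-1.
  by rewrite /qfun; field.
have : (psi rho (r i) - psi rho x) / t i * (r i)^-1 -
    psi rho x / x * ((r i - x) / t i) * (r i)^-1 @[i --> G] -->
    (psi rho)^`()%classic x * c * x^-1 - psi rho x / x * c * x^-1.
  by apply: cvgB; apply: cvgM => //; apply: cvgMl_tmp.
apply: cvg_trans; apply: near_eq_cvg; near=> i.
have ri0 : r i != 0.
  by near: i; exact: (cvgr_neq0 x).
rewrite /phi (negbTE ri0) (negbTE x_neq0).
(* If [t i] is 0, both quotients are 0 by the convention for division. *)
have [->|t0] := eqVneq (t i) 0; first by rewrite invr0 !(mulr0, mul0r) subrr.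
by field; rewrite x_neq0 t0 ri0.
Unshelve. all: by end_near. Qed.

End loss.

(** * Limits of difference quotients in the Hilbert space *)

Section pointwise_limits.
Context {R : realType} {H : normedModType R} (dot : {dot H for idfun}).
Hypothesis dotE : forall g : H, `|g| ^+ 2 = dot g g.
Context {rho : R -> R}.
Hypotheses (drho : loss_differentiable rho) (Arho : loss_assumptions rho).

Lemma cvg_loss_quotient0 (w : nat -> H) :
  w @ \oo --> (0 : H) -> rho `|w n| / `|w n| @[n --> \oo] --> (0 : R).
Proof.
move=> w0; apply/cvgr0Pnorm_lt => e e0.
have [d /= d0 small] : \forall y \near (0 : R)^'+, `|rho y / y| < e.
  by move: (loss_small Arho) => /cvgr0Pnorm_lt/(_ _ e0).
near=> n.
(* The sequence may hit 0, where the quotient is 0 by convention. *)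
have [->|wn] := eqVneq (w n) 0; first by rewrite normr0 invr0 mulr0 normr0.
apply: small; rewrite /= ?normr_gt0// sub0r normrN normr_id.
by near: n; move/cvgr0Pnorm_lt : w0; exact.
Unshelve. all: by end_near. Qed.

Context (u v : H) (w : nat -> H) (t : nat -> R).
Hypotheses (t_gt0 : forall n, 0 < t n) (wu : w @ \oo --> u)
  (wv : (t n)^-1 *: (w n - u) @[n --> \oo] --> v).

(** Away from 0 this is the chain rule through the norm. At [u = 0] the norm is not differentiable,
    but [rho y / y] tends to 0 and multiplies a quotient of norms that converges. *)
Lemma cvg_loss_norm_quotient :
  (rho `|w n| - rho `|u|) / t n @[n --> \oo] --> phi rho `|u| * dot u v.
Proof.
have [u0|u0] := eqVneq u 0.
  rewrite u0 linear0l mulr0 normr0 (loss_0 Arho) -[X in _ --> X](mul0r `|v|).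
  have -> : (fun n => (rho `|w n| - 0) / t n) =
      (fun n => (rho `|w n| / `|w n|) * `|(t n)^-1 *: (w n - u)|).
    apply/funext => n; rewrite u0 !subr0 normrZ gtr0_norm ?invr_gt0//.
    have [->|wn] := eqVneq `|w n| 0; first by rewrite (loss_0 Arho) !mul0r.
    by field; rewrite gt_eqF//= wn.
  apply: cvgM; first by apply: cvg_loss_quotient0; rewrite -u0.
  exact: cvg_norm.
have -> : phi rho `|u| * dot u v = psi rho `|u| * (dot v u / `|u|).
  by rewrite (psiE Arho) (dotC dot v); field; rewrite normr_eq0.
apply: cvg_difference_quotient; last exact: cvg_norm_quotient.
- by apply: is_derive_loss => //; rewrite normr_gt0.
- exact: cvg_norm.
Qed.

(** Product rule. At [u = 0] the factor [dot u h] makes the summand with the variation of [phi]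
    vanish; elsewhere the quotient rule for [phi] applies. *)
Lemma cvg_gradient_quotient h : (0 < `|u| -> derivable (psi rho) `|u| 1) ->
  (phi rho `|w n| * dot (w n) h - phi rho `|u| * dot u h) / t n @[n --> \oo] -->
  phi rho `|u| * dot v h + dot v u / `|u| ^+ 3 * qfun rho `|u| * dot u h.
Proof.
move=> dpsi.
have [L L0 phiL] := phi_lipschitzP Arho.
have -> : (fun n => (phi rho `|w n| * dot (w n) h - phi rho `|u| * dot u h) / t n) =
  (fun n => phi rho `|w n| * dot ((t n)^-1 *: (w n - u)) h +
            (phi rho `|w n| - phi rho `|u|) / t n * dot u h).
  by apply/funext => n; rewrite linearZl_LR /= (linearBl dot h); field; rewrite gt_eqF.
apply: cvgD.
  apply: cvgM; last by apply: cvg_dot => //; exact: cvg_cst.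
  by apply: (cvg_lipschitz_ge0 _ _ phiL) => //; exact: cvg_norm.
have [->|u0] := eqVneq u 0.
  by rewrite linear0l mulr0; under eq_fun do rewrite mulr0; exact: cvg_cst.
have nu0 : `|u| != 0 by rewrite normr_eq0.
apply: cvgMr_tmp.
have -> : dot v u / `|u| ^+ 3 * qfun rho `|u| =
  qfun rho `|u| / `|u| ^+ 2 * (dot v u / `|u|) by field.
apply: cvg_phi_quotient => //; rewrite ?normr_gt0//.
- by apply: dpsi; rewrite normr_gt0.
- exact: cvg_norm.
- exact: cvg_norm_quotient.
Qed.

End pointwise_limits.

(** * Integration *)

(* Neither function need be measurable: the integral of a nonnegative function
   is a supremum over the simple functions below it, and multiplying these by
   the indicator of [~` N] does not change their integral. *)
Lemma ge0_integral_eq_negligible {d} {T : measurableType d} {R : realType}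
    (mu : {measure set T -> \bar R}) (N : set T) (f g : T -> \bar R) :
  measurable N -> mu N = 0%E -> (forall x, 0 <= f x)%E -> (forall x, 0 <= g x)%E ->
  (forall x, ~ N x -> f x = g x) -> (\int[mu]_x f x = \int[mu]_x g x)%E.
Proof.
move=> mN N0.
suff le f' g' : (forall x, 0 <= f' x)%E -> (forall x, 0 <= g' x)%E ->
    (forall x, ~ N x -> f' x = g' x) -> (\int[mu]_x f' x <= \int[mu]_x g' x)%E.
  move=> f0 g0 fg; apply/le_anti; rewrite !le//.
  by move=> x Nx; rewrite fg.
move=> f0 g0 fg; rewrite ge0_integralTE//; apply: ge_ereal_sup => _ [h hf <-].
pose h' : {nnsfun T >-> R} := proj_nnsfun h (measurableC mN).
have -> : sintegral mu h = sintegral mu h'.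
  rewrite -!integralT_nnsfun; apply: ge0_ae_eq_integral => //.
  - by apply/measurable_EFinP.
  - by apply/measurable_EFinP.
  - by move=> x _; rewrite lee_fin.
  - by move=> x _; rewrite lee_fin.
  - exists N; split => // x /=; apply: contra_notP => Nx _.
    by rewrite /h' /= /mindic indicE mem_set// mulr1.
rewrite [leRHS]ge0_integralTE//; apply: ereal_sup_ubound; exists h' => //= x.
have [Nx|Nx] := pselect (N x).
  by rewrite /mindic indicE memNset ?mulr0//; exact.
by rewrite -fg// /mindic indicE mem_set// mulr1 hf.
Qed.

(** A null set [N] of [F] may contain [x'], which the mixture charges. Hence [f] is compared with
    [g'], equal to [f] at [x'] and to [g] elsewhere: [g'] is measurable, and differs from [f] only
    inside [N] without [x'], a null set of the mixture. *)
Lemma ge0_integral_contaminate d (T : measurableType d) (R : realType)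
    (F : probability T R) (x' : T) (N : set T) (f g : T -> R) (s : R) :
  measurable [set x'] -> measurable N -> F N = 0%E ->
  (forall x, 0 <= f x) -> (forall x, 0 <= g x) -> measurable_fun setT g ->
  (forall x, ~ N x -> f x = g x) -> 0 <= s < 1 ->
  (\int[contaminate F x' s]_x (f x)%:E =
   (1 - s)%:E * (\int[F]_x (g x)%:E) + s%:E * (f x')%:E)%E.
Proof.
move=> mx' mN N0 f0 g0 mg fg s01.
pose g' x := if x \in [set x'] then f x' else g x.
have mg' : measurable_fun setT g'.
  apply: measurable_fun_ifT => //; apply: (measurable_fun_bool true) => //.
  rewrite setTI (_ : _ @^-1` _ = [set x'])//; apply/seteqP; split => x /=.
    by move/set_mem.
  by move=> ->; exact/mem_set.
have g'0 x : 0 <= g' x by rewrite /g'; case: ifPn.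
have mN' : measurable (N `\ x') by exact: measurableD.
have -> : (\int[contaminate F x' s]_x (f x)%:E =
    \int[contaminate F x' s]_x (g' x)%:E)%E.
  apply: (ge0_integral_eq_negligible _ (N `\ x')) => //.
  - rewrite [LHS](contaminateE F x' (N `\ x') s01).
    rewrite (subset_measure0 mN' mN _ N0); last by move=> x [].
    by rewrite diracE memNset ?mule0 ?adde0// => -[_ /=]; exact.
  - move=> x Nx; rewrite /g'; case: ifPn => [/set_mem ->//|/negP xx'].
    by rewrite fg// => Nx'; apply: Nx; split => // x'x; apply: xx'; rewrite inE.
have mEg' : measurable_fun [set: T] (fun x => (g' x)%:E) by exact/measurable_EFinP.
rewrite /contaminate ge0_integral_measure_add//; last by move=> x _; rewrite lee_fin.
have Eg' : (\int[F]_x (g' x)%:E = \int[F]_x (g x)%:E)%E.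
  apply: (ge0_integral_eq_negligible _ N) => //.
  by move=> x Nx; rewrite /g'; case: ifPn => [/set_mem <-|//]; rewrite fg.
have dirac_g' : (\int[\d_x']_x (g' x)%:E = (f x')%:E)%E.
  by rewrite integral_dirac// diracT mul1e /g' mem_set.
have clipE : clip01 s = s.
  by case/andP: s01 => s0 s1; rewrite /clip01 max_r // min_r // ltW.
rewrite !ge0_integral_mscale//=; do 3 ?by move=> x _; rewrite lee_fin.
by rewrite clipE Eg' -dirac_g'.
Qed.

(** * Simple functions and measurability of their limits *)

Section simple_functions.
Context {d} {T : measurableType d} {R : realType}.

(** The operation [op] is arbitrary: only finitely many pairs of values occur, so each preimage is a
    finite union of intersections of level sets. *)
Lemma simple_fun_comp2 {U V W : normedModType R} (op : U -> V -> W)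
    {s1 : T -> U} {s2 : T -> V} :
  simple_fun s1 -> simple_fun s2 -> simple_fun (fun x => op (s1 x) (s2 x)).
Proof.
move=> [fin1 m1] [fin2 m2].
have preE (B : set W) : (fun x => op (s1 x) (s2 x)) @^-1` B =
    \bigcup_(p in (range s1 `*` range s2) `&` [set p | B (op p.1 p.2)])
      (s1 @^-1` [set p.1] `&` s2 @^-1` [set p.2]).
  apply/seteqP; split=> [x Bx|x [[a b] [[/= _ _] Bab] [/= -> ->]]//].
  by exists (s1 x, s2 x) => //; split => //; split; exists x.
split; last first.
  move=> v; rewrite preE; apply: fin_bigcup_measurable => [|p _].
    by apply: finite_setIl; exact: finite_setX.
  exact: measurableI.
apply: (@sub_finite_set _ _ ((fun p => op p.1 p.2) @` (range s1 `*` range s2))).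
  by move=> _ [x _ <-]; exists (s1 x, s2 x) => //; split; exists x.
exact/finite_image/finite_setX.
Qed.

Lemma simple_fun_comp {U V : normedModType R} (op : U -> V) {s : T -> U} :
  simple_fun s -> simple_fun (fun x => op (s x)).
Proof.
by move=> ss; exact: (simple_fun_comp2 (fun a _ => op a) ss ss).
Qed.

Lemma simple_fun_patch {V : normedModType R} {s : T -> V} {N : set T} (v : V) :
  measurable N -> simple_fun s -> simple_fun (fun x => if x \in N then v else s x).
Proof.
move=> mN [fs ms]; split.
  apply: (@sub_finite_set _ _ (v |` range s)).
    by move=> _ [x _ <-]; case: ifPn => _; [left|right; exists x].
  by rewrite finite_setU; split.
move=> w; rewrite (_ : _ @^-1` _ = (N `&` [set _ | v = w]) `|`
    (s @^-1` [set w] `\` N)); last first.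
  apply/seteqP; split => x /=.
    case: ifPn => [/set_mem Nx vw|/negP Nx sw]; [by left|right; split => //].
    by apply: contra_not Nx => Nx; exact/mem_set.
  by case=> [[Nx vw]|[sw Nx]]; [rewrite mem_set|rewrite memNset].
apply: measurableU; last exact: measurableD.
have [->|vw] := pselect (v = w).
  by rewrite (_ : [set _ | w = w] = setT) ?setIT//; apply/seteqP; split.
by rewrite (_ : [set _ | v = w] = set0) ?setI0//; apply/seteqP; split => //.
Qed.

Lemma simple_fun_measurable {s : T -> R} :
  simple_fun (s : T -> R^o) -> measurable_fun setT s.
Proof.
move=> [fs ms] _ B mB; rewrite setTI.
rewrite (_ : s @^-1` B = \bigcup_(v in range s `&` B) (s @^-1` [set v])).
  by apply: fin_bigcup_measurable => [|v _]; [exact: finite_setIl|exact: ms].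
apply/seteqP; split=> [x Bx|x [v [_ Bv] /= ->//]].
by exists (s x) => //; split => //; exists x.
Qed.

(** No sigma-algebra is put on [V]: measurability is obtained for scalar functions of [f], as limits
    of simple scalar functions. *)
Lemma measurable_continuous_comp {V : normedModType R} {s : nat -> T -> V}
    {f : T -> V} {g : V -> R} :
  (forall n, simple_fun (s n)) -> (forall x, s n x @[n --> \oo] --> f x) ->
  continuous g -> measurable_fun setT (g \o f).
Proof.
move=> ss sf cg; apply: (@measurable_fun_cvg _ _ _ _ (fun n => g \o s n)).
  move=> n; apply: simple_fun_measurable.
  exact: (simple_fun_comp (g : V -> R^o)).
by move=> x _; apply: continuous_cvg; [exact: cg|exact: sf].
Qed.

End simple_functions.

(** * Bounded integrands under a probability *)

Section bounded_integral.
Context {d} {T : measurableType d} {R : realType} (F : probability T R).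

Lemma bounded_integrable {f : T -> R} {C : R} : measurable_fun setT f ->
  (forall x, `|f x| <= C) -> F.-integrable setT (EFin \o f).
Proof.
move=> mf fC; apply: (le_integrable _ _ _ (finite_measure_integrable_cst F C _)) => //.
  exact/measurable_EFinP.
by move=> x _; rewrite /= lee_fin (le_trans (fC x))// ler_norm.
Qed.

Lemma cvg_Rintegral_bounded {f_ : nat -> T -> R} {f : T -> R} {C : R} :
  (forall n, measurable_fun setT (f_ n)) -> (forall n x, `|f_ n x| <= C) ->
  (forall x, f_ n x @[n --> \oo] --> f x) ->
  \int[F]_x f_ n x @[n --> \oo] --> \int[F]_x f x.
Proof.
move=> mf fC ff.
have fC' x : `|f x| <= C.
  by apply: (cvgr_to_le (cvg_norm (ff x))); near=> n.
have mf' : measurable_fun setT f by apply: (measurable_fun_cvg mf) => x _; exact: ff.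
have fi := bounded_integrable mf' fC'.
apply: fine_cvg; rewrite fineK; last exact: integrable_fin_num.
apply: (@dominated_cvg _ _ _ _ _ _ _ _ (EFin \o cst C)) => //.
- by move=> n; exact/measurable_EFinP.
- by move=> x _; apply: cvg_EFin => //; [near=> n|exact: ff].
- exact: finite_measure_integrable_cst.
- by move=> n x _; rewrite /= lee_fin.
Unshelve. all: by end_near. Qed.

Lemma Rintegral_sum {I : Type} (r : seq I) (f : I -> T -> R) :
  (forall i, F.-integrable setT (EFin \o f i)) ->
  \int[F]_x (\sum_(i <- r) f i x) = \sum_(i <- r) \int[F]_x f i x.
Proof.
move=> fi.
suff [] : F.-integrable setT (EFin \o (fun x => \sum_(i <- r) f i x)) /\
  \int[F]_x (\sum_(i <- r) f i x) = \sum_(i <- r) \int[F]_x f i x by [].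
elim: r => [|i r [IHi IHE]].
  split; last by under eq_Rintegral do rewrite big_nil; rewrite Rintegral_cst// mul0r big_nil.
  by apply: (eq_integrable _ (EFin \o cst 0)) => //; [move=> x _ /=; rewrite big_nil|
    exact: finite_measure_integrable_cst].
split.
  apply: (eq_integrable _ (fun x => (f i x)%:E + (\sum_(i <- r) f i x)%:E)%E) => //.
    by move=> x _ /=; rewrite big_cons EFinD.
  exact: (integrableD _ (fi i) IHi).
rewrite big_cons -IHE -RintegralD//; apply: eq_Rintegral => x _.
by rewrite big_cons.
Qed.

End bounded_integral.

(** * Bochner integrals of bounded functions from their weak integrals *)

Section bochner.
Context {d} {T : measurableType d} {R : realType} (F : probability T R)
  (H : normedModType R) (dot : {dot H for idfun}).
Hypothesis dotE : forall g : H, `|g| ^+ 2 = dot g g.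

Lemma dot_simple_integral {s : T -> H} h : simple_fun s ->
  dot (simple_integral F s) h = \int[F]_x dot (s x) h.
Proof.
move=> [fs ms]; rewrite /simple_integral.
pose r := finmap.enum_fset (fset_set (range s)).
(* Only the level set through [x] contributes to the sum. *)
have dot_sE x : dot (s x) h = \sum_(v <- r) dot v h * \1_(s @^-1` [set v]) x.
  rewrite -fsbig_finite//= (fsbigD1 (s x))//=; last by exists x.
  rewrite /indic mem_set// mulr1.
  rewrite fsbig1 ?addr0//= => v [_ /= vsx].
  by rewrite memNset ?mulr0// => /= /esym.
have i1 v : F.-integrable setT (EFin \o (\1_(s @^-1` [set v]) : T -> R)).
  apply: (bounded_integrable F (C := 1)); first exact: measurable_indic.
  by move=> x; rewrite indicE; case: (_ \in _); rewrite ?normr0 ?normr1.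
under eq_Rintegral do rewrite dot_sE.
rewrite Rintegral_sum; last first.
  move=> v.
  apply: (eq_integrable _ (fun x => (dot v h)%:E * (\1_(s @^-1` [set v]) x)%:E)%E) => //.
  exact: (integrableZl measurableT (dot v h) (i1 v)).
rewrite fsbig_finite//= linear_sumlz; apply: eq_bigr => v _.
rewrite RintegralZl// linearZl_LR /= mulrC; congr (_ * _).
by rewrite /Rintegral integral_indic// setIT.
Qed.

(** The everywhere limit [f0] carries the measurability and the bound, while [f] itself is arbitrary
    on the null set [N]. *)
Lemma is_bochner_bounded (f f0 : T -> H) (N : set T) (s : nat -> T -> H) (M : R) (I : H) :
  measurable N -> F N = 0%E -> (forall x, ~ N x -> f x = f0 x) ->
  (forall n, simple_fun (s n)) -> (forall x, s n x @[n --> \oo] --> f0 x) ->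
  (forall x, `|f0 x| <= M) -> (forall h, dot I h = \int[F]_x dot (f0 x) h) ->
  is_bochner F f I.
Proof.
move=> mN N0 ff0 ss sf f0M IE.
(* Truncation makes the approximants uniformly bounded. As [f0] is bounded by [M], the threshold
   [M + 1] is eventually inactive at each point, so the limit is unchanged. *)
pose t n x := if `|s n x| <= M + 1 then s n x else 0.
have st n : simple_fun (t n).
  exact: (simple_fun_comp (fun v => if `|v| <= M + 1 then v else 0) (ss n)).
have tf x : t n x @[n --> \oo] --> f0 x.
  apply: cvg_trans (sf x); apply: near_eq_cvg; near=> n.
  rewrite /t ifT//; near: n.
  by apply: (cvgr_norm_le _ (sf x)); rewrite (le_lt_trans (f0M x))// ltrDl.
have tM n x : `|t n x| <= M + 1.
  rewrite /t; case: ifPn => //; rewrite normr0 addr_ge0//.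
  exact: le_trans (f0M x).
pose e n x := `|f0 x - t n x|.
have me n : measurable_fun setT (e n).
  apply: (measurable_continuous_comp (s := fun m x => s m x - t n x) (g := fun v => `|v|)).
  - by move=> m; apply: (simple_fun_comp2 (fun u v => u - v)).
  - by move=> x; apply: cvgB; [exact: sf|exact: cvg_cst].
  - exact: norm_continuous.
have eM n x : `|e n x| <= M + (M + 1).
  by rewrite /e normr_id (le_trans (ler_normB _ _))// lerD.
have ie : \int[F]_x e n x @[n --> \oo] --> (0 : R).
  have -> : 0 = \int[F]_x (cst 0 x : R).
    by rewrite Rintegral_cst// mul0r.
  apply: (cvg_Rintegral_bounded _ me eM) => x.
  rewrite -[0](normr0 H) -(subrr (f0 x)); apply: cvg_norm.
  by apply: cvgB; [exact: cvg_cst|exact: tf].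
exists t; split => //.
- exists N; split => // x /=; apply: contra_notP => Nx.
  by rewrite ff0.
- have -> : (fun n => \int[F]_x (`|f x - t n x|)%:E)%E =
      (fun n => (\int[F]_x e n x)%:E).
    apply/funext => n; rewrite /Rintegral fineK; last first.
      by apply: integrable_fin_num => //; apply: (bounded_integrable F (me n) (eM n)).
    apply: (ge0_integral_eq_negligible _ N) => // [x|x Nx].
      by rewrite lee_fin /e.
    by rewrite /e ff0.
  by apply: cvg_EFin => //; near=> n.
- apply/subr_cvg0/norm_cvg0P.
  apply: (@squeeze_cvgr _ _ _ _ (fun=> 0) (fun n => \int[F]_x e n x)) => //; last exact: cvg_cst.
  near=> n; rewrite normr_ge0 /=.
  set w := simple_integral F (t n) - I.
  (* The weak identity is tested on [w] itself: the squared norm of [w] is the integral of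
     [dot (t n x - f0 x) w], at most the norm of [w] times the integral of [e n]. Cancelling one
     factor requires [w] nonzero. *)
  have [->|w0] := eqVneq w 0.
    by rewrite normr0; apply: Rintegral_ge0 => x _; exact: normr_ge0.
  rewrite -(@ler_pM2r _ `|w|) ?normr_gt0// -expr2 dotE {1}/w linearBl /=.
  rewrite dot_simple_integral// IE.
  have it : F.-integrable setT (EFin \o (fun x => dot (t n x) w)).
    apply: (bounded_integrable F (C := (M + 1) * `|w|)) => [|x].
      exact/simple_fun_measurable/(simple_fun_comp (fun v => dot v w : R^o)).
    by rewrite (le_trans (normr_dot_le dot dotE _ _))// ler_wpM2r.
  have if0 : F.-integrable setT (EFin \o (fun x => dot (f0 x) w)).
    apply: (bounded_integrable F (C := M * `|w|)) => [|x].
      apply: (measurable_continuous_comp (g := fun v => dot v w) ss sf) => v.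
      by apply: cvg_dot => //; exact: cvg_cst.
    by rewrite (le_trans (normr_dot_le dot dotE _ _))// ler_wpM2r.
  have ien := bounded_integrable F (me n) (eM n).
  rewrite -RintegralB// -RintegralZr//.
  apply: le_Rintegral => //.
  - apply: (eq_integrable _ (fun x => (dot (t n x) w)%:E - (dot (f0 x) w)%:E)%E) => //.
    exact: integrableB.
  - by apply: (eq_integrable _ (fun x => (e n x)%:E * (`|w|)%:E)%E) => //; exact: integrableZr.
  - move=> x _; rewrite -linearBl /e distrC (le_trans (ler_norm _))//.
    exact: normr_dot_le.
Unshelve. all: by end_near. Qed.

End bochner.

(** * First-order condition and influence equation *)

Section risk.
Context {d} {T : measurableType d} {R : realType} (F : probability T R)
  {H : normedModType R} (dot : {dot H for idfun}).
Hypothesis dotE : forall g : H, `|g| ^+ 2 = dot g g.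
Context {rho : R -> R}.
Hypotheses (drho : loss_differentiable rho) (Arho : loss_assumptions rho).
Context {Phi : T -> H} {s : nat -> T -> H} {C : R}.
Hypotheses (simple_s : forall n, simple_fun (s n))
  (cvg_s : forall x, s n x @[n --> \oo] --> Phi x)
  (Phi_bounded : forall x, `|Phi x| <= C).

Local Notation u g x := (Phi x - g).

Lemma continuous_loss_norm g : continuous (fun v : H => rho `|v - g|).
Proof.
move=> v; have [B B0 rhoB] := loss_lipschitzP drho Arho.
apply: (cvg_lipschitz_ge0 _ _ rhoB) => //; apply: cvg_norm.
by apply: cvgB => //; exact: cvg_cst.
Qed.

Lemma continuous_phi_norm g : continuous (fun v : H => phi rho `|v - g|).
Proof.
move=> v; have [L L0 phiL] := phi_lipschitzP Arho.
apply: (cvg_lipschitz_ge0 _ _ phiL) => //; apply: cvg_norm.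
by apply: cvgB => //; exact: cvg_cst.
Qed.

Lemma continuous_dotB g h : continuous (fun v : H => dot (v - g) h).
Proof.
by move=> v; apply: cvg_dot => //; [apply: cvgB => //|]; exact: cvg_cst.
Qed.

Lemma measurable_loss_norm g : measurable_fun setT (fun x => rho `|u g x|).
Proof. exact: (measurable_continuous_comp simple_s cvg_s (continuous_loss_norm g)). Qed.

Lemma measurable_phi_norm g : measurable_fun setT (fun x => phi rho `|u g x|).
Proof. exact: (measurable_continuous_comp simple_s cvg_s (continuous_phi_norm g)). Qed.

Lemma measurable_dotB g h : measurable_fun setT (fun x => dot (u g x) h).
Proof. exact: (measurable_continuous_comp simple_s cvg_s (continuous_dotB g h)). Qed.

Lemma norm_feature_le g x : `|u g x| <= C + `|g|.
Proof. by rewrite (le_trans (ler_normB _ _))// lerD2r. Qed.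

Lemma integrable_loss_norm g : F.-integrable setT (EFin \o (fun x => rho `|u g x|)).
Proof.
have [B B0 rhoB] := loss_lipschitzP drho Arho.
apply: (bounded_integrable F (C := B * (C + `|g|)) (measurable_loss_norm g)) => x.
have := rhoB `|u g x| 0 (normr_ge0 _) (lexx _).
rewrite (loss_0 Arho) !subr0 normr_id => /le_trans; apply.
by rewrite ler_wpM2l// norm_feature_le.
Qed.

Lemma integrable_gradient g h :
  F.-integrable setT (EFin \o (fun x => phi rho `|u g x| * dot (u g x) h)).
Proof.
have [B B0 phiB] := bounded_ge0P (phi_bounded Arho).
apply: (bounded_integrable F (C := B * ((C + `|g|) * `|h|))) => [|x].
  by apply: measurable_funM; [exact: measurable_phi_norm|exact: measurable_dotB].
rewrite normrM ler_pM// ?phiB// (le_trans (normr_dot_le dot dotE _ _))//.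
by rewrite ler_wpM2r// norm_feature_le.
Qed.

Local Notation risk g := (\int[F]_x rho `|Phi x - g|).

Local Notation gradient g h :=
  (\int[F]_x (phi rho `|Phi x - g| * dot (Phi x - g) h)).

(** Differentiation under the integral: since [rho] is Lipschitz, the difference quotients are
    dominated by the constant [B] times the norm of [h]. *)
Lemma cvg_risk_quotient g h (t := @harmonic R) :
  (risk (g + t n *: h) - risk g) / t n @[n --> \oo] --> - gradient g h.
Proof.
have t_gt0 n : 0 < t n by rewrite /t /harmonic invr_gt0 ltr0n.
have [B B0 rhoB] := loss_lipschitzP drho Arho.
have wu x : u (g + t n *: h) x @[n --> \oo] --> u g x.
  apply: cvgB; first exact: cvg_cst.
  rewrite -[X in _ --> X]addr0 -(scale0r h); apply: cvgD; first exact: cvg_cst.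
  by apply: cvgZl; exact: cvg_harmonic.
have uE x n : u (g + t n *: h) x - u g x = - (t n *: h).
  by rewrite (opprD g) addrA [LHS]addrC addKr.
have wv x : (t n)^-1 *: (u (g + t n *: h) x - u g x) @[n --> \oo] --> - h.
  under eq_fun do rewrite uE scalerN scalerA mulVf ?gt_eqF// scale1r.
  exact: cvg_cst.
have -> : - gradient g h = \int[F]_x (phi rho `|u g x| * dot (u g x) (- h)).
  rewrite -mulN1r -RintegralZl//; last exact: integrable_gradient.
  by apply: eq_Rintegral => x _; rewrite linearNr mulN1r mulrN.
have -> : (fun n => (risk (g + t n *: h) - risk g) / t n) =
    (fun n => \int[F]_x ((rho `|u (g + t n *: h) x| - rho `|u g x|) / t n)).
  apply/funext => n; rewrite RintegralZr//; last first.
    apply: (eq_integrable _ (fun x => (rho `|u (g + t n *: h) x|)%:E - (rho `|u g x|)%:E)%E) => //.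
    exact: (integrableB measurableT (integrable_loss_norm _) (integrable_loss_norm _)).
  rewrite RintegralB//; exact: integrable_loss_norm.
apply: (cvg_Rintegral_bounded F (C := B * `|h|)).
- move=> n; apply: measurable_funM; last exact: measurable_cst.
  by apply: measurable_funB; exact: measurable_loss_norm.
- move=> n x; rewrite normrM normfV (gtr0_norm (t_gt0 n)) ler_pdivrMr//.
  rewrite (le_trans (rhoB _ _ _ _))// -mulrA ler_wpM2l//.
  by rewrite (le_trans (ler_dist_dist _ _))// uE normrN normrZ gtr0_norm// mulrC.
- by move=> x; apply: (cvg_loss_norm_quotient dot dotE drho Arho).
Qed.

(** The weights are [1 - s] and [s] for the mixture, and 1 and 0 for [F] alone. *)
Lemma risk_stationary (a b : R) (y g h : H) : 0 <= a -> 0 <= b ->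
  (forall g', a * risk g + b * rho `|y - g| <= a * risk g' + b * rho `|y - g'|) ->
  a * gradient g h + b * (phi rho `|y - g| * dot (y - g) h) = 0.
Proof.
move=> a0 b0 gmin.
(* One-sided quotients at a minimizer are nonnegative, which gives one inequality in every
   direction; the direction [- h] turns it into an equality by linearity. *)
suff le0 h' : a * gradient g h' + b * (phi rho `|y - g| * dot (y - g) h') <= 0.
  apply/le_anti; rewrite le0 /=; have := le0 (- h).
  rewrite linearNr /= mulrN.
  have -> : gradient g (- h) = - gradient g h.
    rewrite -mulN1r -RintegralZl//; last exact: integrable_gradient.
    by apply: eq_Rintegral => x _; rewrite linearNr mulN1r mulrN.
  lra.
pose t := @harmonic R.
have t_gt0 n : 0 < t n by rewrite /t /harmonic invr_gt0 ltr0n.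
have wE n : y - (g + t n *: h') - (y - g) = - (t n *: h').
  by rewrite (opprD g) addrA [LHS]addrC addKr.
have wu : y - (g + t n *: h') @[n --> \oo] --> y - g.
  apply: cvgB; first exact: cvg_cst.
  rewrite -[X in _ --> X]addr0 -(scale0r h'); apply: cvgD; first exact: cvg_cst.
  by apply: cvgZl; exact: cvg_harmonic.
have wv : (t n)^-1 *: (y - (g + t n *: h') - (y - g)) @[n --> \oo] --> - h'.
  under eq_fun do rewrite wE scalerN scalerA mulVf ?gt_eqF// scale1r.
  exact: cvg_cst.
rewrite -oppr_ge0.
have -> : - (a * gradient g h' + b * (phi rho `|y - g| * dot (y - g) h')) =
    a * - gradient g h' + b * (phi rho `|y - g| * dot (y - g) (- h')).
  by rewrite linearNr /=; ring.
have lim1 := cvg_risk_quotient g h'.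
have lim2 := cvg_loss_norm_quotient dot dotE drho Arho _ _ _ _ t_gt0 wu wv.
apply: (cvgr_to_ge (cvgD (cvgMl_tmp (a := a) lim1) (cvgMl_tmp (a := b) lim2))).
near=> n.
rewrite -[leRHS]/(a * ((risk (g + t n *: h') - risk g) / t n) +
  b * ((rho `|y - (g + t n *: h')| - rho `|y - g|) / t n)) !mulrA -mulrDl.
apply: divr_ge0; last exact: ltW.
by rewrite !mulrBr; have := gmin (g + t n *: h'); lra.
Unshelve. all: by end_near. Qed.

(** The first-order condition is differentiated along the minimizers, again under the integral. *)
Lemma cvg_gradient_integral (g fd h : H) (f : nat -> H) (t : nat -> R) :
  (forall n, 0 < t n) -> f @ \oo --> g ->
  (t n)^-1 *: (f n - g) @[n --> \oo] --> fd ->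
  (forall x, 0 < `|u g x| -> derivable (psi rho) `|u g x| 1) ->
  (gradient (f n) h - gradient g h) / t n @[n --> \oo] -->
  \int[F]_x (phi rho `|u g x| * dot (- fd) h +
    dot (- fd) (u g x) / `|u g x| ^+ 3 * qfun rho `|u g x| * dot (u g x) h).
Proof.
move=> t_gt0 fg tfd dpsi.
have [L L0 phiL] := phi_lipschitzP Arho.
have [B B0 phiB] := bounded_ge0P (phi_bounded Arho).
(* A convergent sequence of quotients is bounded, so [f n - g] is of order [t n]. *)
have [K K0 fK] : exists2 K, 0 <= K & forall n, `|f n - g| <= K * t n.
  have /cvg_seq_bounded[M [_ fM]] : cvgn (fun n => (t n)^-1 *: (f n - g)).
    by apply/cvg_ex; exists fd.
  exists (Num.max M 0 + 1); first by rewrite addr_ge0// le_max lexx orbT.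
  move=> n; rewrite -ler_pdivrMr//.
  have -> : `|f n - g| / t n = `|(t n)^-1 *: (f n - g)|.
    by rewrite normrZ gtr0_norm ?invr_gt0// mulrC.
  by apply: fM => //; rewrite (@le_lt_trans _ _ (Num.max M 0)) ?ltrDl// le_max lexx.
have uE x n : u (f n) x - u g x = - (f n - g).
  by rewrite opprB addrC addrA subrK opprB.
have wu x : u (f n) x @[n --> \oo] --> u g x by apply: cvgB => //; exact: cvg_cst.
have wv x : (t n)^-1 *: (u (f n) x - u g x) @[n --> \oo] --> - fd.
  under eq_fun do rewrite uE scalerN; exact: cvgN.
have -> : (fun n => (gradient (f n) h - gradient g h) / t n) =
    (fun n => \int[F]_x ((phi rho `|u (f n) x| * dot (u (f n) x) h -
      phi rho `|u g x| * dot (u g x) h) / t n)).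
  apply/funext => n; rewrite RintegralZr//; last first.
    apply: (eq_integrable _ (fun x => (phi rho `|u (f n) x| * dot (u (f n) x) h)%:E -
      (phi rho `|u g x| * dot (u g x) h)%:E)%E) => //.
    exact: (integrableB measurableT (integrable_gradient _ _) (integrable_gradient _ _)).
  by rewrite RintegralB//; exact: integrable_gradient.
(* The constant comes from splitting the increment of the product: [B] bounds [phi] against the
   change of the vector, and [L] bounds the change of [phi] against a vector of norm at most [C]
   plus the norm of [g]. *)
apply: (cvg_Rintegral_bounded F (C := (B + L * (C + `|g|)) * (K * `|h|))).
- move=> n; apply: measurable_funM; last exact: measurable_cst.
  by apply: measurable_funB; apply: measurable_funM;
    (exact: measurable_phi_norm || exact: measurable_dotB).
- move=> n x; rewrite normrM normfV (gtr0_norm (t_gt0 n)) ler_pdivrMr//.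
  have -> : phi rho `|u (f n) x| * dot (u (f n) x) h - phi rho `|u g x| * dot (u g x) h =
    phi rho `|u (f n) x| * dot (u (f n) x - u g x) h +
    (phi rho `|u (f n) x| - phi rho `|u g x|) * dot (u g x) h.
    by rewrite (linearBl dot h (u (f n) x) (u g x)); ring.
  have wK : `|u (f n) x - u g x| <= K * t n by rewrite uE normrN.
  have -> : (B + L * (C + `|g|)) * (K * `|h|) * t n =
    B * (K * t n * `|h|) + L * (K * t n) * ((C + `|g|) * `|h|) by ring.
  rewrite (le_trans (ler_normD _ _))// lerD// normrM ler_pM//.
  + exact: phiB.
  + by rewrite (le_trans (normr_dot_le dot dotE _ _))// ler_wpM2r.
  + rewrite (le_trans (phiL _ _ _ _))// ler_wpM2l//.
    exact: le_trans (ler_dist_dist _ _) wK.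
  + by rewrite (le_trans (normr_dot_le dot dotE _ _))// ler_wpM2r// norm_feature_le.
- by move=> x; apply: (cvg_gradient_quotient dot dotE Arho) => //; exact: dpsi.
Qed.

Local Notation coef g fd x :=
  (dot fd (Phi x - g) / `|Phi x - g| ^+ 3 * qfun rho `|Phi x - g|).

(** The coefficient contains the derivative of [psi], whose measurability and size are not given. It
    is a pointwise limit of difference quotients of [phi] in the direction [fd], which are
    measurable and bounded through the Lipschitz constant of [phi]. *)
Lemma coef_measurable_bounded (g fd : H) :
  (forall x, 0 < `|u g x| -> derivable (psi rho) `|u g x| 1) ->
  measurable_fun setT (fun x => coef g fd x) /\
  exists2 M, 0 <= M & forall x, `|coef g fd x| <= M.
Proof.
move=> dpsi; have [L L0 phiL] := phi_lipschitzP Arho.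
pose t := @harmonic R.
have t_gt0 n : 0 < t n by rewrite /t /harmonic invr_gt0 ltr0n.
pose A := [set x | `|u g x| != 0].
have mA : measurable A.
  have mu : measurable_fun setT (fun x => `|u g x|).
    apply: (measurable_continuous_comp (g := fun v => `|v - g|) simple_s cvg_s) => v.
    by apply: cvg_norm; apply: cvgB => //; exact: cvg_cst.
  rewrite (_ : A = (fun x => `|u g x|) @^-1` ~` [set 0]).
    by rewrite -[X in measurable X]setTI; apply: mu => //; exact: measurableC.
  by apply/seteqP; split => x /= /eqP.
pose w n x := u (g - t n *: fd) x.
have wE n x : w n x - u g x = t n *: fd.
  by rewrite /w (opprB g) (addrC (t n *: fd)) addrA [LHS]addrC addKr.
(* The indicator of [A] forces the value 0 where the norm vanishes: there the coefficient is 0 by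
   division by 0, while the quotient of [phi] need not tend to 0. *)
pose c n x := (phi rho `|w n x| - phi rho `|u g x|) / t n * \1_A x.
have mc n : measurable_fun setT (c n).
  apply: measurable_funM; last exact: measurable_indic.
  apply: measurable_funM; last exact: measurable_cst.
  by apply: measurable_funB; exact: measurable_phi_norm.
have cM n x : `|c n x| <= L * `|fd|.
  rewrite /c normrM -[leRHS]mulr1 ler_pM//; last first.
    by rewrite /indic; case: (_ \in _); rewrite ?normr0 ?normr1.
  rewrite normrM normfV (gtr0_norm (t_gt0 n)) ler_pdivrMr//.
  rewrite (le_trans (phiL _ _ _ _))// -mulrA ler_wpM2l//.
  by rewrite (le_trans (ler_dist_dist _ _))// wE normrZ gtr0_norm// mulrC.
have cc x : c n x @[n --> \oo] --> coef g fd x.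
  have [u0|u0] := eqVneq `|u g x| 0.
    have -> : coef g fd x = 0.
      by rewrite u0 expr0n invr0 mulr0 mul0r.
    rewrite /c /indic memNset; last by rewrite /A /= u0 eqxx.
    by under eq_fun do rewrite mulr0; exact: cvg_cst.
  have -> : coef g fd x =
      qfun rho `|u g x| / `|u g x| ^+ 2 * (dot fd (u g x) / `|u g x|) * 1.
    by field.
  rewrite /c /indic mem_set//; apply: cvgMr_tmp.
  have ux0 : 0 < `|u g x| by rewrite lt_neqAle eq_sym u0 normr_ge0.
  have wu : w n x @[n --> \oo] --> u g x.
    have -> : w^~ x = (fun n => t n *: fd + u g x).
      by apply/funext => n; rewrite -(wE n x) subrK.
    rewrite -[X in _ --> X]add0r -(scale0r fd); apply: cvgD; last exact: cvg_cst.
    by apply: cvgZl; exact: cvg_harmonic.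
  apply: (cvg_phi_quotient (r := fun n => `|w n x|) ux0 (dpsi x ux0)) => //.
    exact: cvg_norm.
  apply: cvg_norm_quotient => //; first by rewrite -normr_eq0.
  under eq_fun do rewrite wE scalerA mulVf ?gt_eqF// scale1r.
  exact: cvg_cst.
split; first by apply: (measurable_fun_cvg mc) => x _; exact: cc.
exists (L * `|fd|); first exact: mulr_ge0.
by move=> x; apply: (cvgr_to_le (cvg_norm (cc x))); near=> n.
Unshelve. all: by end_near. Qed.

(** The same difference quotient of gradients has two limits, one by differentiation under the
    integral and one by the first-order conditions; uniqueness of limits equates them. *)
Lemma influence_equation (y g fd h : H) (f : nat -> H) (t : nat -> R) :
  (forall n, 0 < t n) -> t @ \oo --> (0 : R) -> f @ \oo --> g ->
  (t n)^-1 *: (f n - g) @[n --> \oo] --> fd ->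
  (forall x, 0 < `|u g x| -> derivable (psi rho) `|u g x| 1) ->
  gradient g h = 0 ->
  (forall n, (1 - t n) * gradient (f n) h +
    t n * (phi rho `|y - f n| * dot (y - f n) h) = 0) ->
  (\int[F]_x phi rho `|u g x|) * dot fd h +
  \int[F]_x (coef g fd x * dot (u g x) h) = phi rho `|y - g| * dot (y - g) h.
Proof.
move=> t_gt0 t0 fg tfd dpsi grad0 gradn.
have [B B0 phiB] := bounded_ge0P (phi_bounded Arho).
have [mcoef [M M0 coefM]] := coef_measurable_bounded g fd dpsi.
have iphi : F.-integrable setT (EFin \o (fun x => phi rho `|u g x|)).
  by apply: (bounded_integrable F (C := B) (measurable_phi_norm g)) => x; exact: phiB.
have icoef : F.-integrable setT (EFin \o (fun x => coef g fd x * dot (u g x) h)).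
  apply: (bounded_integrable F (C := M * ((C + `|g|) * `|h|))) => [|x].
    by apply: measurable_funM => //; exact: measurable_dotB.
  rewrite normrM ler_pM// (le_trans (normr_dot_le dot dotE _ _))//.
  by rewrite ler_wpM2r// norm_feature_le.
have lim1 := cvg_gradient_integral g fd h f t t_gt0 fg tfd dpsi.
have limE : \int[F]_x (phi rho `|u g x| * dot (- fd) h +
      dot (- fd) (u g x) / `|u g x| ^+ 3 * qfun rho `|u g x| * dot (u g x) h) =
    - ((\int[F]_x phi rho `|u g x|) * dot fd h +
    \int[F]_x (coef g fd x * dot (u g x) h)).
  rewrite -RintegralZr// -RintegralD//; last first.
    by apply: (eq_integrable _ (fun x => (phi rho `|u g x|)%:E * (dot fd h)%:E)%E) => //;
      exact: integrableZr.
  rewrite -mulN1r -RintegralZl//.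
    apply: eq_Rintegral => x _; rewrite (linearNl dot h) (linearNl dot (u g x)); ring.
  apply: (eq_integrable _ (fun x => (phi rho `|u g x|)%:E * (dot fd h)%:E +
    (coef g fd x * dot (u g x) h)%:E)%E) => //.
  by apply: integrableD => //; exact: integrableZr.
rewrite limE in lim1.
(* Solving the condition for the mixture shows that [gradient (f n) h / t n] is minus the term at
   [y] divided by [1 - t n], and the gradient at [g] is 0. *)
have lim2 : (gradient (f n) h - gradient g h) / t n @[n --> \oo] -->
    - (phi rho `|y - g| * dot (y - g) h) / (1 - 0).
  have : - (phi rho `|y - f n| * dot (y - f n) h) / (1 - t n) @[n --> \oo] -->
      - (phi rho `|y - g| * dot (y - g) h) / (1 - 0).
    have yf : y - f n @[n --> \oo] --> y - g by apply: cvgB => //; exact: cvg_cst.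
    apply: cvgM; [apply: cvgN; apply: cvgM|apply: cvgV].
    - have [L L0 phiL] := phi_lipschitzP Arho.
      by apply: (cvg_lipschitz_ge0 _ _ phiL) => //; exact: cvg_norm.
    - by apply: cvg_dot => //; exact: cvg_cst.
    - by rewrite subr0 oner_neq0.
    - by apply: cvgB => //; exact: cvg_cst.
  apply: cvg_trans; apply: near_eq_cvg; near=> n.
  have t1 : 1 - t n != 0.
    rewrite subr_eq0 eq_sym lt_eqF//; near: n.
    by apply: (cvgr_lt (0 : R)).
  have tn0 : t n != 0 by rewrite gt_eqF.
  rewrite grad0 subr0; apply: (mulfI t1); have /eqP := gradn n.
  rewrite addr_eq0 => /eqP gn; rewrite (mulrA _ (gradient _ _)) gn; field.
  by rewrite t1 tn0.
apply: oppr_inj; rewrite -[RHS]divr1 -[X in _ = _ / X]subr0.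
exact: (cvg_unique (@norm_hausdorff _ _) lim1 lim2).
Unshelve. all: by end_near. Qed.

End risk.

(** * The influence function and the equation for its representer *)

Theorem theorem4 (R : realType) (d : nat)
    (k : d.-tuple R -> d.-tuple R -> R) (kernelk : density_kernel k)
    (H : completeNormedModType R) (dot : {dot H for idfun})
    (ev : H -> d.-tuple R -> R) (Phi : d.-tuple R -> H)
    (rkhsH : is_rkhs k dot ev Phi)
    (rho : R -> R) (drho : loss_differentiable rho)
    (Arho : loss_assumptions rho)
    (F : probability (d.-tuple R) R) (x' : d.-tuple R)
    (fmin : probability (d.-tuple R) R -> H)
    (fminF : is_argmin (robust_risk rho Phi F) (fmin F))
    (fminFs : forall s : R, 0 <= s < 1 ->
      is_argmin (robust_risk rho Phi (contaminate F x' s))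
                (fmin (contaminate F x' s)))
    (mPhi : strongly_measurable F Phi)
    (dpsi : {ae F, forall x, 0 < `|Phi x - fmin F| ->
      derivable (psi rho) `|Phi x - fmin F| 1})
    (cvgf : fmin (contaminate F x' s) @[s --> 0^'+] --> fmin F)
    (fdot : H)
    (cvgfdot : s^-1 *: (fmin (contaminate F x' s) - fmin F)
      @[s --> 0^'+] --> fdot) :
  (forall x : d.-tuple R,
     cvg (influence_quotient (rkde ev fmin) F x x' s @[s --> 0^'+]) /\
     influence_function (rkde ev fmin) F x x' = dot (Phi x) fdot) /\
  exists I : H,
    is_bochner F
      (fun x => (dot fdot (Phi x - fmin F) / `|Phi x - fmin F| ^+ 3
                 * qfun rho `|Phi x - fmin F|) *: (Phi x - fmin F)) I /\
    (\int[F]_x phi rho `|Phi x - fmin F|) *: fdot + I =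
    phi rho `|Phi x' - fmin F| *: (Phi x' - fmin F).
Proof.
set f := fmin F.
have dotE := rkhs_norm rkhsH.
(* The squared norm of [Phi x] is [k x x], that is [g0 0], whatever [x] is. *)
have features_norm x : `|Phi x| = `|Phi x'|.
  have [g0 kE] := kernel_radial kernelk.
  apply/eqP; rewrite -(@eqrXn2 _ 2)// !dotE -!(rkhs_reproducing rkhsH).
  rewrite !(rkhs_feature rkhsH) !kE.
  have sqdist0 y : sqdist y y = 0 :> R.
    by rewrite /sqdist big1// => i _; rewrite subrr expr0n.
  by rewrite !sqdist0.
split=> [x|].
  have lim : influence_quotient (rkde ev fmin) F x x' s @[s --> 0^'+] -->
      dot (Phi x) fdot.
    have -> : influence_quotient (rkde ev fmin) F x x' =
        (fun s => dot (Phi x) (s^-1 *: (fmin (contaminate F x' s) - f))).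
      apply/funext => s; rewrite /influence_quotient /rkde !(rkhs_reproducing rkhsH).
      by rewrite linearZr_LR linearBr /= mulrC.
    by apply: cvg_dot => //; exact: cvg_cst.
  by split; [apply/cvg_ex; exists (dot (Phi x) fdot)|exact/cvg_lim].
have [s [simple_s cvg_s]] := mPhi.
(* [F] need not be complete: [Phi] is replaced by [fmin F] on a measurable null
   set [N] containing its exceptional points, after which everything is measurable. *)
have [N [mN N0 notN]] : F.-negligible (~` [set x | s n x @[n --> \oo] --> Phi x /\
    (0 < `|Phi x - f| -> derivable (psi rho) `|Phi x - f| 1)]).
  by apply: filterS2 cvg_s dpsi => x ? ?; split.
have {notN}goodP x : ~ N x -> s n x @[n --> \oo] --> Phi x /\
    (0 < `|Phi x - f| -> derivable (psi rho) `|Phi x - f| 1).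
  by apply: contra_notP => bad; apply: notN.
pose Phi0 x := if x \in N then f else Phi x.
pose s0 n x := if x \in N then f else s n x.
have Phi0E x : ~ N x -> Phi0 x = Phi x by move=> Nx; rewrite /Phi0 memNset.
have simple_s0 n : simple_fun (s0 n) by exact: simple_fun_patch.
have cvg_s0 x : s0 n x @[n --> \oo] --> Phi0 x.
  rewrite /s0 /Phi0; case: ifPn => [_|/negP Nx]; first exact: cvg_cst.
  by apply: (goodP x _).1 => Nx'; apply: Nx; exact/mem_set.
(* With the value [f] on [N], the difference [Phi0 x - f] is 0 there and the premise fails, so
   differentiability of [psi] holds at every point required. *)
have dpsi0 x : 0 < `|Phi0 x - f| -> derivable (psi rho) `|Phi0 x - f| 1.
  rewrite /Phi0; case: ifPn => [_|/negP Nx]; first by rewrite subrr normr0 ltxx.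
  by apply: (goodP x _).2 => Nx'; apply: Nx; exact/mem_set.
pose C := `|Phi x'| + `|f|.
have Phi0C x : `|Phi0 x| <= C.
  by rewrite /Phi0 /C; case: ifPn => _; rewrite ?features_norm ?lerDl ?lerDr.
have mrho g := measurable_loss_norm drho Arho simple_s0 cvg_s0 g.
have irho g := integrable_loss_norm F drho Arho simple_s0 cvg_s0 Phi0C g.
pose risk g := \int[F]_x rho `|Phi0 x - g|.
have riskE g : (risk g)%:E = (\int[F]_x (rho `|Phi0 x - g|)%:E)%E.
  by rewrite /risk /Rintegral fineK//; exact: (integrable_fin_num measurableT (irho g)).
have mx' : measurable [set x'].
  rewrite (_ : [set x'] = \bigcap_(i in [set: 'I_d]) ((@tnth d R ^~ i) @^-1` [set tnth x' i])).
    apply: fin_bigcap_measurable => // i _; rewrite -[X in measurable X]setTI.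
    exact: measurable_tnth.
  apply/seteqP; split => [x -> i _//|x xx'].
  by apply: eq_from_tnth => i; exact: xx'.
have stationaryF h : \int[F]_x (phi rho `|Phi0 x - f| * dot (Phi0 x - f) h) = 0.
  have riskF g : robust_risk rho Phi F g = (risk g)%:E.
    rewrite riskE; apply: (ge0_integral_eq_negligible _ N) => // [x|x|x Nx].
    - by rewrite lee_fin loss_ge0.
    - by rewrite lee_fin loss_ge0.
    - by rewrite Phi0E.
  (* The condition for [F] is the weighted one with weights 1 and 0. *)
  rewrite -[LHS]mul1r -[LHS]addr0.
  rewrite -[X in _ + X](mul0r (phi rho `|Phi x' - f| * dot (Phi x' - f) h)).
  apply: (risk_stationary F dot dotE drho Arho simple_s0 cvg_s0 Phi0C) => // g'.
  rewrite !mul1r !mul0r !addr0.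
  by have := fminF g'; rewrite !riskF lee_fin.
(* The atom keeps the true value [Phi x'], even if [x'] lies in [N]; only the integral against [F]
   uses [Phi0]. *)
have stationary_mix e h : 0 <= e < 1 -> let fe := fmin (contaminate F x' e) in
    (1 - e) * (\int[F]_x (phi rho `|Phi0 x - fe| * dot (Phi0 x - fe) h)) +
    e * (phi rho `|Phi x' - fe| * dot (Phi x' - fe) h) = 0.
  move=> e01 fe; have /andP[e0 e1] := e01.
  have riskF g : robust_risk rho Phi (contaminate F x' e) g =
      ((1 - e) * risk g + e * rho `|Phi x' - g|)%:E.
    rewrite EFinD !EFinM riskE.
    apply: (ge0_integral_contaminate _ _ _ F x' N (fun x => rho `|Phi x - g|)) => // [x|x|x Nx].
    - exact: loss_ge0.
    - exact: loss_ge0.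
    - by rewrite Phi0E.
  apply: (risk_stationary F dot dotE drho Arho simple_s0 cvg_s0 Phi0C) => //.
    by rewrite subr_ge0 ltW.
  by move=> g'; have := fminFs e e01 g'; rewrite !riskF lee_fin.
(* The shift excludes the first harmonic term, which is 1: the mixture weights must be below 1. *)
pose t n : R := harmonic n.+1.
have t_gt0 n : 0 < t n by rewrite /t /harmonic invr_gt0 ltr0n.
have t_lt1 n : t n < 1 by rewrite /t /harmonic invf_lt1 ?ltr1n ?ltr0n.
have t0 : t @ \oo --> (0 : R).
  by have := @cvg_harmonic R; rewrite -cvg_shiftS.
have t0r : t @ \oo --> (0 : R)^'+.
  move=> A /t0 At; suff : \oo (t @^-1` A) by [].
  by apply: (@filterS _ \oo _ [set n | 0 < t n -> A (t n)]) => // n; exact.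
have eqn h := influence_equation F dot dotE Arho simple_s0 cvg_s0 Phi0C
  (Phi x') f fdot h (fun n => fmin (contaminate F x' (t n))) t t_gt0 t0
  (cvg_comp _ _ t0r cvgf) (cvg_comp _ _ t0r cvgfdot) dpsi0 (stationaryF h)
  (fun n => stationary_mix (t n) h (introT andP (conj (ltW (t_gt0 n)) (t_lt1 n)))).
have [mcoef [M M0 coefM]] :=
  coef_measurable_bounded dot dotE Arho simple_s0 cvg_s0 f fdot dpsi0.
set c := Rintegral _ _ _.
have cE : c = \int[F]_x phi rho `|Phi0 x - f|.
  rewrite /c /Rintegral; congr fine.
  apply: (ge0_integral_eq_negligible _ N) => // [x|x|x Nx].
  - by rewrite lee_fin phi_ge0.
  - by rewrite lee_fin phi_ge0.
  - by rewrite Phi0E.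
(* The equation dictates the value of the integral; it remains to see that this vector is the
   Bochner integral. *)
exists (phi rho `|Phi x' - f| *: (Phi x' - f) - c *: fdot); split; last by rewrite addrC subrK.
(* Simple scalar approximants [a n] of the coefficient, multiplied by [s0 n x - f], are simple
   approximants of the vector integrand. *)
have [a acoef] := approximation_sfun measurableT ((measurable_EFinP _ _).2 mcoef).
have simple_a n : simple_fun (a n : d.-tuple R -> R^o).
  by split; [exact: fimfunP|move=> v; exact: measurable_funPTI].
have cvg_a x : a n x @[n --> \oo] -->
    dot fdot (Phi0 x - f) / `|Phi0 x - f| ^+ 3 * qfun rho `|Phi0 x - f|.
  exact: (fine_cvg (acoef x I)).
apply: (is_bochner_bounded F _ dot dotE _
  (fun x => (dot fdot (Phi0 x - f) / `|Phi0 x - f| ^+ 3 *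
    qfun rho `|Phi0 x - f|) *: (Phi0 x - f))
  N (fun n x => a n x *: (s0 n x - f)) (M * (C + `|f|))) => //.
- by move=> x Nx; rewrite Phi0E.
- by move=> n; apply: (simple_fun_comp2 (fun (b : R^o) v => b *: (v - f))).
- move=> x; apply: cvgZ => //; apply: cvgB => //; exact: cvg_cst.
- by move=> x; rewrite normrZ ler_pM// (le_trans (ler_normB _ _))// lerD2r.
(* The weak identity is exactly [eqn h]. *)
- move=> h; rewrite linearBl !linearZl_LR /= -eqn -cE [LHS]addrC addKr.
  by apply: eq_Rintegral => x _; rewrite (linearZl_LR dot h).
Qed.
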